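(* Let $v\ge 4$ be a multiple of $3$. The hypergraph $K_v^{(3)}-I$ admits a decomposition into tight $6$-cycles if and only if $v\equiv 0,3,6 \pmod{12}$.
   Context: $K_v^{(3)}$ denotes the complete $3$-uniform hypergraph on $v$ vertices (all $3$-element subsets of the vertex set are edges). For $3\mid v$, $K_v^{(3)}-I$ denotes the hypergraph obtained from $K_v^{(3)}$ by deleting the edges of a $1$-factor $I$, i.e. a set of $v/3$ pairwise disjoint triples covering all vertices (the choice of $I$ is irrelevant up to isomorphism). A (3-uniform tight) $k$-cycle is given by a cyclic sequence $v_1,v_2,\dots,v_k$ of $k$ distinct vertices, its edges being the $k$ triples $\{v_i,v_{i+1},v_{i+2}\}$, $i=1,\dots,k$, with indices taken modulo $k$. A decomposition of a hypergraph $\mathcal H$ into $k$-cycles is a collection of $k$-cycles (sub-hypergraphs of $\mathcal H$) whose edge sets partition the edge set of $\mathcal H$. *)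

(* Defs.v *)
From mathcomp Require Import all_boot.
Set Implicit Arguments. Unset Strict Implicit. Unset Printing Implicit Defensive.

(* Vertex set {0,...,v-1} = 'I_v; a 3-uniform hypergraph is a set of 3-subsets. *)

Definition complete3 (v : nat) : {set {set 'I_v}} :=
  [set e : {set 'I_v} | #|e| == 3].

Definition one_factor (v : nat) (I : {set {set 'I_v}}) : bool :=
  [&& I \subset complete3 v, trivIset I & cover I == [set: 'I_v]].

Definition complete3_minus (v : nat) (I : {set {set 'I_v}}) : {set {set 'I_v}} :=
  complete3 v :\: I.

(* A tight k-cycle given by a cyclic sequence c_0,...,c_{k-1} of distinct
   vertices; its edges are {c_i, c_{i+1}, c_{i+2}}, indices mod k. *)
Definition tight_cycle (k v : nat) (c : {ffun 'I_k -> 'I_v}) : bool :=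
  injectiveb c.

Definition cycle_edges (k v : nat) (c : {ffun 'I_k -> 'I_v}) : {set {set 'I_v}} :=
  [set [set c i; c (ordS i); c (ordS (ordS i))] | i : 'I_k].

Definition k_cycle_decomposition (k v : nat) (H : {set {set 'I_v}})
    (cs : seq {ffun 'I_k -> 'I_v}) : Prop :=
  (forall c, c \in cs -> tight_cycle c /\ cycle_edges c \subset H) /\
  (forall e, e \in H -> count (fun c => e \in cycle_edges c) cs = 1).

Definition has_k_cycle_decomposition (k v : nat) (H : {set {set 'I_v}}) : Prop :=
  exists cs : seq {ffun 'I_k -> 'I_v}, k_cycle_decomposition H cs.

(* Main.v *)
(** Necessity is an edge count: with [v = 3 u] the hypergraph has [9 u^2 (u - 1) / 2]
    edges, which is a multiple of 6 only if [u mod 4 <> 3].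

    For sufficiency, view the [u] triples of [I] as groups. The edges meeting exactly
    two given groups form a copy of [K_6 - I], which is a union of three 6-cycles.
    The 27 edges transversal to three groups do not split into 6-cycles, but those
    transversal to {a, b, c} or {a, b, d} do: they form a complete tripartite
    hypergraph with parts of sizes 3, 3, 6. It remains to match the triples of groups
    so that partners share two groups. Passing from [n] to [n + 2] groups, match
    {i, j, n} with {i, j, n + 1}, and the [n] triples {i, n, n + 1} among themselves
    when [n] is even. When [n] is odd, pass to [n + 4] groups: the two unmatched
    triples {0, n, n + 1} and {0, n + 2, n + 3} are absorbed by {0, n, n + 2} and
    {0, n, n + 3}. *)
Require Import Defs.
From mathcomp Require Import all_boot.
From mathcomp Require Import zify.
Set Implicit Arguments. Unset Strict Implicit. Unset Printing Implicit Defensive.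

(** * Tight 6-cycles and edge weights that are sums of cycles *)

Section Cycles.

Variable v : nat.
Implicit Types (c : {ffun 'I_6 -> 'I_v}) (e : {set 'I_v}) (g : nat -> 'I_v).

Definition cycle_edge c (i : 'I_6) : {set 'I_v} :=
  [set c i; c (ordS i); c (ordS (ordS i))].

(** If edges [i] and [j] coincide, the vertices at positions [i] and [i + 2] both sit at offsets 0,
    1 or 2 from [j]. Modulo 6 such offsets differ by 2 only as 0 and 2, so [i = j]. *)
Lemma cycle_edge_inj c : tight_cycle c -> injective (cycle_edge c).
Proof.
move=> /injectiveP cI i j ij.
have: c i \in cycle_edge c j by rewrite -ij !inE eqxx.
have: c (ordS (ordS i)) \in cycle_edge c j by rewrite -ij !inE eqxx !orbT.
rewrite !inE !(inj_eq cI) -!val_eqE => h1 h2; apply: val_inj => /=.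
move: h1 h2; case: i {ij} => i /= hi; case: j => j /= hj; lia.
Qed.

Lemma card_cycle_edges c : tight_cycle c -> #|cycle_edges c| = 6.
Proof.
by move=> /cycle_edge_inj cI; rewrite [LHS](card_imset _ cI) card_ord.
Qed.

Lemma mem_cycle_edges c e : tight_cycle c ->
  (e \in cycle_edges c) = \sum_(i < 6) (e == cycle_edge c i) :> nat.
Proof.
move=> tc; have [/imsetP[i _ ->]|he] := boolP (e \in _).
  rewrite (bigD1 i) //= eqxx big1 // => j ji.
  by rewrite [_ == _](inj_eq (cycle_edge_inj tc)) eq_sym (negbTE ji).
rewrite big1 // => i _; case: eqP => // ee; case/negP: he.
by rewrite ee; apply/imsetP; exists i.
Qed.

(* Edge multiplicities instead of edge sets: weights add up without any
   disjointness side condition. *)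
Definition decomposable (w : {set 'I_v} -> nat) : Prop :=
  exists cs : seq {ffun 'I_6 -> 'I_v},
    {in cs, forall c, tight_cycle c} /\
    forall e, count (fun c => e \in cycle_edges c) cs = w e.

Lemma decomposable_ext w1 w2 : w1 =1 w2 -> decomposable w1 -> decomposable w2.
Proof. by move=> h [cs [t H]]; exists cs; split=> // e; rewrite H h. Qed.

Lemma decomposable0 : decomposable (fun=> 0).
Proof. by exists [::]. Qed.

Lemma decomposableD w1 w2 : decomposable w1 -> decomposable w2 ->
  decomposable (fun e => w1 e + w2 e).
Proof.
move=> [cs [t H]] [cs' [t' H']]; exists (cs ++ cs'); split=> [c|e].
  by rewrite mem_cat => /orP[/t|/t'].
by rewrite count_cat H H'.
Qed.

Lemma decomposable_sum (T : eqType) (s : seq T) (w : T -> {set 'I_v} -> nat) :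
  {in s, forall i, decomposable (w i)} ->
  decomposable (fun e => \sum_(i <- s) w i e).
Proof.
elim: s => [_|i s IH h].
  by apply: decomposable_ext decomposable0 => e; rewrite big_nil.
apply: decomposable_ext (_ : decomposable (fun e => w i e + \sum_(i <- s) w i e)).
  by move=> e; rewrite big_cons.
apply: decomposableD; first by apply: h; rewrite mem_head.
by apply: IH => j js; apply: h; rewrite inE js orbT.
Qed.

Lemma decomposable_nat_sum m n (w : nat -> {set 'I_v} -> nat) :
  (forall i, m <= i < n -> decomposable (w i)) ->
  decomposable (fun e => \sum_(m <= i < n) w i e).
Proof. by move=> h; apply: decomposable_sum => i; rewrite mem_index_iota => /h. Qed.

Definition triple_weight g (x y z : nat) e : nat := e == [set g x; g y; g z].

Lemma triple_weightC12 g x y z e :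
  triple_weight g x y z e = triple_weight g y x z e.
Proof. by rewrite /triple_weight (setUC [set g x]). Qed.

Lemma triple_weightC23 g x y z e :
  triple_weight g x y z e = triple_weight g x z y e.
Proof. by rewrite /triple_weight setUAC. Qed.

Definition weight g (t : nat * nat * nat) := triple_weight g t.1.1 t.1.2 t.2.

(** A normal form for triples of labels, so that equality of edge lists can be checked by
    computation. *)
Definition sort_triple (t : nat * nat * nat) : nat * nat * nat :=
  let s := sort leq [:: t.1.1; t.1.2; t.2] in (nth 0 s 0, nth 0 s 1, nth 0 s 2).

Lemma weight_sort g t e : weight g (sort_triple t) e = weight g t e.
Proof.
case: t => [[x y] z]; rewrite /weight /sort_triple /triple_weight /=.
congr (nat_of_bool (_ == _)); set s := sort _ _.
have ps : perm_eq s [:: x; y; z] by rewrite perm_sort.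
have: map g s =i map g [:: x; y; z] by apply/perm_mem/perm_map.
have: size s = 3 by rewrite (perm_size ps).
case: s {ps} => [|a [|b [|c [|]]]] //= _ h.
by apply/setP=> p; move: (h p); rewrite !inE !orbA.
Qed.

Definition tight_triples (s : seq nat) : seq (nat * nat * nat) :=
  let x := nth 0 s in
  [:: (x 0, x 1, x 2); (x 1, x 2, x 3); (x 2, x 3, x 4);
      (x 3, x 4, x 5); (x 4, x 5, x 0); (x 5, x 0, x 1)].

Definition tight_label n (s : seq nat) :=
  [&& size s == 6, uniq s & all (gtn n) s].

Lemma decomposable_cycle g n s :
  {in gtn n &, injective g} -> tight_label n s ->
  decomposable (fun e => \sum_(t <- tight_triples s) weight g t e).
Proof.
move=> gI /and3P[/eqP ss us /allP as_].
pose c : {ffun 'I_6 -> 'I_v} := [ffun i : 'I_6 => g (nth 0 s i)].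
have tc : tight_cycle c.
  apply/injectiveP => i j; rewrite !ffunE => /gI.
  have hi (k : 'I_6) : nth 0 s k \in gtn n by apply: as_; rewrite mem_nth ?ss.
  move=> /(_ (hi i) (hi j)) /eqP; rewrite nth_uniq ?ss // => /eqP; exact: val_inj.
exists [:: c]; split=> [c'|e]; first by rewrite inE => /eqP ->.
rewrite /= addn0 mem_cycle_edges // !big_ord_recl big_ord0 !big_cons big_nil.
by rewrite /weight /triple_weight /cycle_edge !ffunE.
Qed.

(** Reduces a decomposition to a computation on numerals: injectivity of [g] makes the label cycles
    genuine cycles, and the weights agree once both lists of triples do, up to order within and
    among the triples. *)
Lemma decomposable_labels g n (cyc : seq (seq nat)) (L : seq (nat * nat * nat)) :
  {in gtn n &, injective g} -> all (tight_label n) cyc ->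
  perm_eq (map sort_triple (flatten (map tight_triples cyc))) (map sort_triple L) ->
  decomposable (fun e => \sum_(t <- L) weight g t e).
Proof.
move=> gI /allP ac pL.
apply: decomposable_ext (_ : decomposable (fun e =>
    \sum_(s <- cyc) \sum_(t <- tight_triples s) weight g t e)).
  move=> e; rewrite -(big_map _ predT (fun l => \sum_(t <- l) weight g t e)).
  rewrite -big_flatten /=.
  rewrite -(eq_bigr _ (fun t _ => weight_sort g t e)).
  rewrite -[RHS](eq_bigr _ (fun t _ => weight_sort g t e)).
  rewrite -(big_map sort_triple predT (fun t => weight g t e)).
  rewrite -[RHS](big_map sort_triple predT (fun t => weight g t e)).
  exact: perm_big.
by apply: decomposable_sum => s /ac; apply: decomposable_cycle.
Qed.

End Cycles.

(** * Regrouping sums over increasing triples by groups of three consecutive indices *)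

Section Sums.

Definition sum3 (G : nat -> nat) i := G (3 * i) + G (3 * i).+1 + G (3 * i).+2.

Definition pairs3 (G : nat -> nat -> nat) i :=
  G (3 * i) (3 * i).+1 + G (3 * i) (3 * i).+2 + G (3 * i).+1 (3 * i).+2.

Definition pairs33 (G : nat -> nat -> nat) i j := sum3 (fun x => sum3 (G x) j) i.

(** For [i < j], the 18 triples with two entries in group [i] and one in group [j], then those with
    one and two. *)
Definition pair_block (G : nat -> nat -> nat -> nat) i j :=
  sum3 (fun z => pairs3 (fun x y => G x y z) i) j +
  sum3 (fun x => pairs3 (G x) j) i.

Definition triple_block (G : nat -> nat -> nat -> nat) i j k :=
  sum3 (fun z => pairs33 (fun x y => G x y z) i j) k.

Lemma sum_by3 (G : nat -> nat) u :
  \sum_(0 <= x < 3 * u) G x = \sum_(0 <= i < u) sum3 G i.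
Proof.
elim: u => [|u IH]; first by rewrite muln0 !big_geq.
rewrite mulnS addnC addn3 !big_nat_recr //= IH /sum3; lia.
Qed.

Lemma sum_pairs_by3 (G : nat -> nat -> nat) u :
  \sum_(0 <= y < 3 * u) \sum_(0 <= x < y) G x y =
  \sum_(0 <= j < u) \sum_(0 <= i < j) pairs33 G i j + \sum_(0 <= i < u) pairs3 G i.
Proof.
elim: u => [|u IH]; first by rewrite muln0 !big_geq.
rewrite mulnS addnC addn3 !big_nat_recr //= IH !sum_by3.
rewrite /pairs33 /pairs3 /sum3 /= !big_split /=; lia.
Qed.

Lemma big_split_pairs (F1 F2 : nat -> nat -> nat) u :
  \sum_(0 <= j < u) \sum_(0 <= i < j) (F1 i j + F2 i j) =
  \sum_(0 <= j < u) \sum_(0 <= i < j) F1 i j +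
  \sum_(0 <= j < u) \sum_(0 <= i < j) F2 i j.
Proof. by rewrite -big_split; apply: eq_bigr => j _; rewrite big_split. Qed.

(** The entries of a triple lie in three, two or one groups. The induction adds one group, so its
    three indices are peeled off as new values of [z], then of [y]. *)
Lemma sum_triples_by3 (G : nat -> nat -> nat -> nat) u :
  \sum_(0 <= z < 3 * u) \sum_(0 <= y < z) \sum_(0 <= x < y) G x y z =
  \sum_(0 <= k < u) \sum_(0 <= j < k) \sum_(0 <= i < j) triple_block G i j k +
  \sum_(0 <= j < u) \sum_(0 <= i < j) pair_block G i j +
  \sum_(0 <= i < u) G (3 * i) (3 * i).+1 (3 * i).+2.
Proof.
elim: u => [|u IH]; first by rewrite muln0 !big_geq.
rewrite mulnS addnC addn3 !big_nat_recr //= IH.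
rewrite !(sum_pairs_by3 (fun x y => G x y _)) !(sum_by3 (fun x => G x _ _)).
rewrite /triple_block /pair_block /sum3 /= !big_split_pairs.
rewrite /pairs3 /= !big_split /=; lia.
Qed.

Lemma sum_nat_eq n a (K : nat -> nat) :
  \sum_(0 <= i < n) (i == a) * K i = (a < n) * K a.
Proof.
elim: n => [|n IH]; first by rewrite big_geq.
rewrite big_nat_recr //= IH; case: eqP => [->|na]; first by rewrite ltnn ltnS leqnn.
by rewrite mul0n addn0; have -> : (a < n.+1) = (a < n) by lia.
Qed.

End Sums.

(** * Every 3-subset arises from exactly one increasing triple of labels *)

Section AllTriples.

Variables (v : nat) (F : nat -> 'I_v).
Hypothesis F_inj : {in gtn v &, injective F}.

Lemma sorted_preimages (e : {set 'I_v}) :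
  exists s, [/\ sorted ltn s, all (gtn v) s, size s = #|e| & e =i map F s].
Proof.
exists [seq x <- iota 0 v | F x \in e]; set s := filter _ _.
have sv : all (gtn v) s.
  by apply/allP => x; rewrite mem_filter mem_iota => /and3P[].
have es : e =i map F s.
  have FI : injective (fun i : 'I_v => F i).
    by move=> i j /F_inj ij; apply/val_inj/ij; rewrite inE /=.
  move=> p; apply/idP/mapP => [pe|[x + ->]]; last by rewrite mem_filter => /andP[].
  have [x px] : exists x : 'I_v, p = F x.
    by have /codomP[x ->] := injF_onto FI p; exists x.
  by exists (val x); rewrite // mem_filter -px pe mem_iota /=.
split=> //; first by apply: sorted_filter (iota_ltn_sorted _ _); apply: ltn_trans.
rewrite -(size_map F) cardE; apply: perm_size; apply: uniq_perm.
- rewrite map_inj_in_uniq ?filter_uniq ?iota_uniq // => x y xs ys.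
  by apply: F_inj; [exact: (allP sv) | exact: (allP sv)].
- exact: enum_uniq.
- by move=> p; rewrite mem_enum es.
Qed.

Lemma sum_all_triples (e : {set 'I_v}) :
  \sum_(0 <= z < v) \sum_(0 <= y < z) \sum_(0 <= x < y) triple_weight F x y z e
  = (#|e| == 3).
Proof.
have [s [ss sv se es]] := sorted_preimages e.
have Feq x y : x < v -> y < v -> (F x == F y) = (x == y).
  by move=> xv yv; apply/eqP/eqP => [/F_inj->|->].
have [e3|e3] := eqVneq #|e| 3; last first.
  rewrite big_nat big1 // => z zv; rewrite big_nat big1 // => y yz.
  rewrite big_nat big1 // => x xy; rewrite /triple_weight.
  apply/eqP; rewrite eqb0; apply: contra e3 => /eqP->.
  by rewrite setUC cardsU1 cards2 !inE !Feq; lia.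
move: se ss sv es; rewrite e3.
case: s => [|a [|b [|c [|]]]] //= _ /and3P[ab bc _] /and4P[av bv cv _] es.
have E x y z : x < y < z -> z < v ->
    triple_weight F x y z e = (x == a) * ((y == b) * (z == c)).
  move=> /andP[xy yz] zv; rewrite /triple_weight !mulnb; congr nat_of_bool.
  apply/eqP/and3P => [ee|[/eqP-> /eqP-> /eqP->]]; last first.
    by apply/setP=> p; rewrite es !inE orbA.
  (* Both label triples are increasing, so they agree entrywise once they have the same elements. *)
  have H t : t < v -> (t \in [:: a; b; c]) = (t \in [:: x; y; z]).
    move=> tv; have := es (F t); rewrite {1}ee !inE !Feq ?orbA //; lia.
  move: (H a av) (H b bv) (H c cv); by rewrite !inE !eqxx ?orbT /= => Ha Hb Hc; split; lia.
transitivity (\sum_(0 <= z < v) \sum_(0 <= y < z) \sum_(0 <= x < y)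
    (x == a) * ((y == b) * (z == c))).
  rewrite !big_nat; apply: eq_bigr => z zv; rewrite !big_nat; apply: eq_bigr => y yz.
  by rewrite !big_nat; apply: eq_bigr => x xy; apply: E; lia.
(* Each sum collapses to one term and leaves its range condition as a factor; [a < b], [b < c] and
   [c < v] make all three equal to 1. *)
under eq_bigr => z _ do under eq_bigr => y _ do
  rewrite (sum_nat_eq _ _ (fun=> _)) mulnCA.
under eq_bigr => z _ do
  rewrite (sum_nat_eq _ _ (fun y => (a < y) * (z == c))) mulnA mulnC.
by rewrite (sum_nat_eq _ _ (fun z => (b < z) * (a < b))) ab bc cv.
Qed.

End AllTriples.

(** * Decomposing the blocks of edges between groups *)

Section Blocks.

Variables (v u : nat) (F : nat -> 'I_v).
Hypothesis F_inj : {in gtn (3 * u) &, injective F}.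

Definition triple_block_weight i j k (e : {set 'I_v}) :=
  triple_block (fun x y z => triple_weight F x y z e) i j k.

Definition pair_block_weight i j (e : {set 'I_v}) :=
  pair_block (fun x y z => triple_weight F x y z e) i j.

Local Notation B := triple_block_weight.

Lemma triple_block_weightC12 i j k : B i j k =1 B j i k.
Proof.
move=> e; rewrite /B /triple_block /pairs33 /sum3.
rewrite !(triple_weightC12 F _ (3 * j)) !(triple_weightC12 F _ (3 * j).+1).
rewrite !(triple_weightC12 F _ (3 * j).+2); lia.
Qed.

Lemma triple_block_weightC23 i j k : B i j k =1 B i k j.
Proof.
move=> e; rewrite /B /triple_block /pairs33 /sum3.
rewrite !(triple_weightC23 F _ (3 * j)) !(triple_weightC23 F _ (3 * j).+1).
rewrite !(triple_weightC23 F _ (3 * j).+2); lia.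
Qed.

(** The list [s] selects groups: local label [3 * p + r] with [r < 3] becomes element [r] of the
    [p]-th selected group. Explicit cycles on small numerals thus transfer to any groups. *)
Definition block_index (s : seq nat) x := 3 * nth 0 s (x %/ 3) + x %% 3.

Definition block_label (s : seq nat) x := F (block_index s x).

Lemma block_indexE s p : [/\ block_index s (3 * p) = 3 * nth 0 s p,
  block_index s (3 * p).+1 = (3 * nth 0 s p).+1 &
  block_index s (3 * p).+2 = (3 * nth 0 s p).+2].
Proof.
have [d0 d1 d2] : [/\ 3 * p %/ 3 = p, (3 * p).+1 %/ 3 = p & (3 * p).+2 %/ 3 = p].
  by split; lia.
by rewrite /block_index d0 d1 d2; split; lia.
Qed.

Lemma weight_block_label s x y z e : weight (block_label s) (x, y, z) e =
  triple_weight F (block_index s x) (block_index s y) (block_index s z) e.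
Proof. by []. Qed.

Lemma block_label_inj s : uniq s -> all (gtn u) s ->
  {in gtn (3 * size s) &, injective (block_label s)}.
Proof.
move=> us /allP su x y; rewrite !inE /= => hx hy.
have hdiv z : z < 3 * size s -> z %/ 3 < size s by lia.
have hn z : z < 3 * size s -> nth 0 s (z %/ 3) < u.
  by move=> /hdiv zs; apply: su; rewrite mem_nth.
have nx := hn x hx; have ny := hn y hy.
rewrite /block_label /block_index => /F_inj xy.
have {}xy : 3 * nth 0 s (x %/ 3) + x %% 3 = 3 * nth 0 s (y %/ 3) + y %% 3.
  by apply: xy; rewrite inE /=; lia.
have : nth 0 s (x %/ 3) == nth 0 s (y %/ 3) by lia.
rewrite nth_uniq ?hdiv //; lia.
Qed.

Lemma decomposable_pair_block i j : i != j -> i < u -> j < u ->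
  decomposable (pair_block_weight i j).
Proof.
move=> ij iu ju; pose g := block_label [:: i; j].
pose L := [seq (xy, z) | xy <- [:: (0, 1); (0, 2); (1, 2)], z <- iota 3 3]
  ++ [seq (x, yz.1, yz.2) | yz <- [:: (3, 4); (3, 5); (4, 5)], x <- iota 0 3].
have us : uniq [:: i; j] by rewrite /= inE ij.
have su : all (gtn u) [:: i; j] by rewrite /= iu ju.
have gI : {in gtn 6 &, injective g} := block_label_inj us su.
apply: decomposable_ext (_ : decomposable (fun e => \sum_(t <- L) weight g t e)).
  move=> e; rewrite /L /= !big_cons big_nil !weight_block_label.
  have /= [-> -> ->] := block_indexE [:: i; j] 0.
  have /= [-> -> ->] := block_indexE [:: i; j] 1.
  rewrite /pair_block_weight /pair_block /pairs3 /sum3; lia.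
(* With groups {0, 1, 2} and {3, 4, 5}, the 18 edges of these three cycles are all triples of {0,
   ..., 5} except the groups themselves. *)
apply: (decomposable_labels gI (cyc :=
  [:: [:: 0; 1; 3; 2; 4; 5]; [:: 0; 2; 3; 5; 1; 4]; [:: 0; 3; 4; 1; 2; 5]])).
  by [].
by vm_compute.
Qed.

(* The two blocks form the complete tripartite hypergraph on parts of sizes 3, 3, 6,
   which splits into three copies of the one on parts {a0, a1, a2}, {b0, b1, b2},
   {c, d}; the latter is the union of the cycles (a_p, b_q, c, a_q, b_p, d) with
   (p, q) = (0, 1), (1, 2), (2, 0). *)
Lemma decomposable_adjacent_blocks i j k l :
  uniq [:: i; j; k; l] -> all (gtn u) [:: i; j; k; l] ->
  decomposable (fun e => B i j k e + B i j l e).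
Proof.
move=> us su; pose g := block_label [:: i; j; k; l].
pose L := [seq (xy, z) | xy <- [seq (x, y) | x <- iota 0 3, y <- iota 3 3],
                         z <- iota 6 6].
have gI : {in gtn 12 &, injective g} := block_label_inj us su.
apply: decomposable_ext (_ : decomposable (fun e => \sum_(t <- L) weight g t e)).
  move=> e; rewrite /L /= !big_cons big_nil !weight_block_label.
  have /= [-> -> ->] := block_indexE [:: i; j; k; l] 0.
  have /= [-> -> ->] := block_indexE [:: i; j; k; l] 1.
  have /= [-> -> ->] := block_indexE [:: i; j; k; l] 2.
  have /= [-> -> ->] := block_indexE [:: i; j; k; l] 3.
  rewrite /B /triple_block /pairs33 /sum3; lia.
apply: (decomposable_labels gI (cyc :=
  [seq [:: pq.1; 3 + pq.2; 6 + c; pq.2; 3 + pq.1; 9 + c]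
     | pq <- [:: (0, 1); (1, 2); (2, 0)], c <- iota 0 3])).
  by [].
by vm_compute.
Qed.

(** Consecutive values of [i] are paired: their blocks share the groups [a] and [b]. The range has
    even length and must avoid [a] and [b]. *)
Lemma decomposable_star m k a b : m + 2 * k <= u -> a != b -> a < u -> b < u ->
  ~~ (m <= a < m + 2 * k) -> ~~ (m <= b < m + 2 * k) ->
  decomposable (fun e => \sum_(m <= i < m + 2 * k) B i a b e).
Proof.
elim: k => [|k IH] mk ab au bu ma mb.
  by apply: decomposable_ext (decomposable0 _) => e; rewrite big_geq //; lia.
have h : decomposable (fun e =>
    \sum_(m <= i < m + 2 * k) B i a b e +
    (B a b (m + 2 * k) e + B a b (m + 2 * k).+1 e)).
  apply: decomposableD; first by apply: IH; lia.
  by apply: decomposable_adjacent_blocks; rewrite /= ?inE; lia.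
apply: decomposable_ext h => e.
have -> : m + 2 * k.+1 = (m + 2 * k).+2 by lia.
rewrite !big_nat_recr /=; [|lia..].
rewrite -addnA !(triple_block_weightC12 _ a b) !(triple_block_weightC23 a _ b).
by rewrite !(triple_block_weightC23 a b).
Qed.

Definition triples_weight n e :=
  \sum_(0 <= k < n) \sum_(0 <= j < k) \sum_(0 <= i < j) B i j k e.

(** A new triple of groups contains exactly one of [n] and [n + 1], or both. *)
Lemma triples_weightSS n e : triples_weight n.+2 e =
  triples_weight n e +
  \sum_(0 <= j < n) \sum_(0 <= i < j) (B i j n e + B i j n.+1 e) +
  \sum_(0 <= i < n) B i n n.+1 e.
Proof.
rewrite /triples_weight !big_nat_recr //=.
by rewrite (big_split_pairs (fun i j => B i j n e)) !addnA.
Qed.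

Lemma decomposable_twin n a b : a < u -> b < u -> a != b -> n <= a -> n <= b ->
  decomposable (fun e =>
    \sum_(0 <= j < n) \sum_(0 <= i < j) (B i j a e + B i j b e)).
Proof.
move=> au bu ab na nb.
apply: decomposable_nat_sum => j hj; apply: decomposable_nat_sum => i hi.
by apply: decomposable_adjacent_blocks; rewrite /= ?inE; lia.
Qed.

Lemma decomposable_triples_even k : 2 * k <= u -> decomposable (triples_weight (2 * k)).
Proof.
elim: k => [_|k IH ku].
  by apply: decomposable_ext (decomposable0 _) => e; rewrite /triples_weight big_geq.
have -> : 2 * k.+1 = (2 * k).+2 by lia.
apply: decomposable_ext (fsym (triples_weightSS _)) _.
apply: decomposableD; first apply: decomposableD.
- by apply: IH; lia.
- by apply: decomposable_twin; lia.
- by apply: (@decomposable_star 0); lia.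
Qed.

Lemma decomposable_triples_odd k : 4 * k < u -> decomposable (triples_weight (4 * k).+1).
Proof.
elim: k => [_|k IH ku].
  apply: decomposable_ext (decomposable0 _) => e.
  by rewrite /triples_weight muln0 big_nat1 big_geq.
have -> : 4 * k.+1 = (4 * k).+4 by lia.
have IHk : decomposable (triples_weight (4 * k).+1) by apply: IH; lia.
move: IHk; set n := (4 * k).+1 => IHk.
(* The first two summands are the extensions by {n, n + 1} and by {n + 2, n + 3}, with four triples
   through group 0 held back. The last summand pairs these four: two share groups 0 and [n], two
   share 0 and [n + 3]. *)
have h : decomposable (fun e =>
   (triples_weight n e +
    \sum_(0 <= j < n) \sum_(0 <= i < j) (B i j n e + B i j n.+1 e) +
    \sum_(1 <= i < 1 + 2 * (2 * k)) B i n n.+1 e) +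
   (\sum_(0 <= j < n) \sum_(0 <= i < j) (B i j n.+2 e + B i j n.+3 e) +
    \sum_(1 <= i < n) (B i n n.+2 e + B i n n.+3 e) +
    \sum_(0 <= i < n.+1) (B i n.+1 n.+2 e + B i n.+1 n.+3 e) +
    \sum_(1 <= i < 1 + 2 * (2 * k).+1) B i n.+2 n.+3 e) +
   ((B 0 n n.+1 e + B 0 n n.+2 e) + (B 0 n.+3 n e + B 0 n.+3 n.+2 e))).
  apply: decomposableD; first apply: decomposableD.
  - apply: decomposableD; first apply: decomposableD => //.
    + by apply: decomposable_twin; lia.
    + by apply: decomposable_star; lia.
  - apply: decomposableD; first apply: decomposableD; first apply: decomposableD.
    + by apply: decomposable_twin; lia.
    + apply: decomposable_nat_sum => i hi.
      by apply: decomposable_adjacent_blocks; rewrite /= ?inE; lia.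
    + apply: decomposable_nat_sum => i hi.
      by apply: decomposable_adjacent_blocks; rewrite /= ?inE; lia.
    + by apply: decomposable_star; lia.
  - by apply: decomposableD; apply: decomposable_adjacent_blocks;
      rewrite /= ?inE; lia.
apply: decomposable_ext h => e; rewrite !triples_weightSS.
have -> : 1 + 2 * (2 * k).+1 = n.+2 by lia.
have -> : 1 + 2 * (2 * k) = n by lia.
(* To match the two sides, the terms [j = n] and [j = n + 1] of the second extension are split off,
   then the terms [i = 0] that were held back. *)
pose A j := \sum_(0 <= i < j) (B i j n.+2 e + B i j n.+3 e).
rewrite -[\sum_(0 <= j < n.+2) _]/(\sum_(0 <= j < n.+2) A j)
  (big_nat_recr n.+1 0 A) // (big_nat_recr n 0 A) //=.
rewrite /A (big_ltn (F := fun i => B i n n.+1 e) (isT : 0 < n)).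
rewrite (big_ltn (F := fun i => B i n.+2 n.+3 e) (isT : 0 < n.+2)).
rewrite (big_ltn (F := fun i => B i n n.+2 e + B i n n.+3 e) (isT : 0 < n)).
rewrite !(triple_block_weightC23 0 n.+3); lia.
Qed.

End Blocks.

(** * Labelling the vertices along the 1-factor *)

Lemma card_one_factor (v : nat) (I : {set {set 'I_v}}) :
  one_factor I -> v = 3 * #|I|.
Proof.
move=> /and3P[/subsetP I3 tI /eqP cI].
transitivity (\sum_(b in I) #|b|).
  by move/eqP: tI ->; rewrite cI cardsT card_ord.
rewrite (eq_bigr (fun=> 3)) => [|b /I3]; last by rewrite inE => /eqP.
by rewrite sum_nat_const mulnC.
Qed.

Section OneFactor.

Variables (v : nat) (I : {set {set 'I_v}}) (x0 : 'I_v).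
Hypothesis HI : one_factor I.

Let block i := nth set0 (enum I) i.

(** Labels [3 * i], [3 * i + 1], [3 * i + 2] enumerate the [i]-th triple of [I], so groups of labels
    are exactly the triples of the 1-factor. *)
Definition factor_label x := nth x0 (enum (block (x %/ 3))) (x %% 3).

Lemma block_in i : i < #|I| -> block i \in I.
Proof. by move=> iI; rewrite -mem_enum mem_nth // -cardE. Qed.

Lemma size_block i : i < #|I| -> size (enum (block i)) = 3.
Proof.
move=> /block_in; case/and3P: HI => /subsetP I3 _ _ /I3.
by rewrite inE -cardE => /eqP.
Qed.

(** Two labels of one vertex belong to triples of [I] that meet, hence coincide; the positions
    inside the triple then agree too. *)
Lemma factor_label_inj : {in gtn v &, injective factor_label}.
Proof.
move=> x y; rewrite !inE /= => xv yv; have vI := card_one_factor HI.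
have hx : x %/ 3 < #|I| by lia.
have hy : y %/ 3 < #|I| by lia.
have inb z : z %/ 3 < #|I| -> factor_label z \in block (z %/ 3).
  by move=> hz; rewrite -mem_enum mem_nth // size_block ?ltn_mod.
move=> xy; have fx := inb x hx; have := inb y hy; rewrite -xy => fy.
have bxy : block (x %/ 3) = block (y %/ 3).
  case/and3P: HI => _ /trivIsetP tI _; apply/eqP/negPn/negP.
  move=> /(tI _ _ (block_in hx) (block_in hy)).
  by rewrite disjoint_subset => /subsetP/(_ _ fx); rewrite inE fy.
have : x %/ 3 == y %/ 3.
  by move/eqP: bxy; rewrite nth_uniq ?enum_uniq -?cardE.
move: xy => /eqP; rewrite /factor_label bxy nth_uniq ?enum_uniq //.
- by move=> *; lia.
- by rewrite size_block ?ltn_mod.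
- by rewrite size_block ?ltn_mod.
Qed.

Lemma sum_factor_weight e :
  \sum_(0 <= i < #|I|)
    triple_weight factor_label (3 * i) (3 * i).+1 (3 * i).+2 e = (e \in I).
Proof.
transitivity (\sum_(b <- enum I) (e == b)).
  rewrite (big_nth set0) -cardE !big_nat; apply: eq_bigr => i iI; rewrite /triple_weight /factor_label.
  have [-> -> ->] : [/\ 3 * i %/ 3 = i, (3 * i).+1 %/ 3 = i & (3 * i).+2 %/ 3 = i].
    by split; lia.
  have [-> -> ->] : [/\ 3 * i %% 3 = 0, (3 * i).+1 %% 3 = 1 & (3 * i).+2 %% 3 = 2].
    by split; lia.
  congr (nat_of_bool (_ == _)); apply/setP=> p; rewrite -[RHS]mem_enum.
  have := size_block (iI : i < #|I|).
  case: (enum _) => [|a [|b [|c [|]]]] //= _.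
  by rewrite !inE orbA.
transitivity (count_mem e (enum I)); last first.
  by rewrite count_uniq_mem ?enum_uniq // mem_enum.
rewrite -sum1_count [RHS]big_mkcond /=.
by apply: eq_bigr => b _; rewrite /= eq_sym; case: eqP.
Qed.

End OneFactor.

(** * The edge count and the equivalence *)

(** Double counting of incident pairs of an edge and a cycle. *)
Lemma card_decomposition (v : nat) (H : {set {set 'I_v}}) :
  has_k_cycle_decomposition 6 H -> exists s, #|H| = 6 * s.
Proof.
move=> [cs [tcs Hcs]]; exists (size cs).
transitivity (\sum_(e in H) \sum_(c <- cs | e \in cycle_edges c) 1).
  by rewrite -sum1_card; apply: eq_bigr => e eH; rewrite sum1_count Hcs.
rewrite (exchange_big_dep predT) //= big_seq (eq_bigr (fun=> 6)) => [|c /tcs[tc cH]].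
  by rewrite -big_seq big_const_seq count_predT iter_addn_0.
transitivity #|cycle_edges c|; last exact: card_cycle_edges.
rewrite -sum1_card; apply: eq_bigl => e.
by case: (boolP (e \in cycle_edges c)) => [/(subsetP cH)->|_]; rewrite ?andbF.
Qed.

Theorem theorem2 (v : nat) (Hv : 4 <= v) (H3 : 3 %| v)
    (I : {set {set 'I_v}}) (HI : one_factor I) :
  has_k_cycle_decomposition 6 (complete3_minus I) <->
  (v %% 12 == 0) || (v %% 12 == 3) || (v %% 12 == 6).
Proof.
have vI := card_one_factor HI; set u := #|I| in vI.
have sI : I \subset complete3 v by case/and3P: HI.
split=> [/card_decomposition[s cH]|vmod].
  have : #|complete3_minus I| + u = 'C(v, 3).
    rewrite cardsD (setIidPr sI) subnK ?subset_leq_card //.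
    by rewrite card_draws card_ord.
  move=> /(congr1 (muln^~ 3`!)); rewrite /= bin_ffact cH !ffactnS ffactn0 muln1 (_ : 3`! = 6) //.
  (* As 3 divides [v], only the residue 9 has to be excluded. *)
  have [q|] := boolP (v %% 12 == 9); last lia.
  have -> : v = 12 * (v %/ 12) + 9 by lia.
  have -> : u = 4 * (v %/ 12) + 3 by lia.
  move: (v %/ 12) => w.
  (* So 4 divides [v (v - 1) (v - 2)], whereas the other side [6 (6 s + 4 w + 3)] is 2 modulo 4. *)
  have -> : (12 * w + 9).-1 = 4 * (3 * w + 2) by lia.
  rewrite -mulnA mulnCA; set t := (12 * w + 9) * _; lia.
have F_inj := @factor_label_inj v I (Ordinal (ltn_trans (isT : 0 < 3) Hv)) HI.
set F := factor_label _ _ in F_inj.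
have F_inj3 : {in gtn (3 * u) &, injective F} by rewrite -vI.
have dT : decomposable (triples_weight F u).
  (* The residues 0, 3, 6 of [v] modulo 12 give [u] congruent to 0, 1, 2 modulo 4; an odd [u] is
     therefore 1 modulo 4. *)
  have [ou|eu] := boolP (odd u).
    have -> : u = (4 * (u %/ 4)).+1 by lia.
    by apply: (decomposable_triples_odd F_inj3); lia.
  have -> : u = 2 * (u %/ 2) by lia.
  by apply: (decomposable_triples_even F_inj3); lia.
have dP : decomposable (fun e =>
    \sum_(0 <= j < u) \sum_(0 <= i < j) pair_block_weight F i j e).
  apply: decomposable_nat_sum => j ju; apply: decomposable_nat_sum => i ij.
  by apply: (decomposable_pair_block F_inj3); lia.
have [cs [tcs Hcs]] := decomposableD dT dP.
(* The weights of triple blocks, pair blocks and [I] add up to the indicator of all 3-subsets. *)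
have {}Hcs e : count (fun c => e \in cycle_edges c) cs = (e \in complete3_minus I).
  have := sum_triples_by3 (fun x y z => triple_weight F x y z e) u.
  rewrite -vI sum_all_triples // sum_factor_weight //.
  rewrite Hcs !inE; have: e \in I -> #|e| == 3 by move/(subsetP sI); rewrite inE.
  rewrite /triples_weight /triple_block_weight /pair_block_weight.
  by case: (e \in I) (#|e| == 3) => [] [] //= _; lia.
exists cs; split=> [c ccs|e eH]; last by rewrite Hcs eH.
split; first exact: tcs.
(* An edge of [c] has positive count, so it cannot lie outside the hypergraph, where the count is
   0. *)
apply/subsetP => e ec; move: (Hcs e); case: (e \in complete3_minus I) => // /eqP.
by rewrite -leqn0 leqNgt -has_count => /hasPn/(_ c ccs); rewrite ec.
Qed.
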